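(* Let $H_1,H_2$ be real Hilbert spaces. Let $f:H_1\to H_1$ be $L_f$-Lipschitz continuous, and let $B:H_2\to H_1$, $C:H_1\to H_2$, $D:H_2\to H_2$ be bounded linear operators with $D$ semi-coercive, such that the system $(f,B,C,D)$ is $P$-passive with a symmetric positive definite bounded linear operator $P:H_1\to H_1$. Let $\mathcal F:H_2\rightrightarrows H_2$ be maximal monotone with $0\in\mathrm{ri}\big(\mathrm{rge}(C)-\mathrm{rge}(\mathcal F^{-1}+D)\big)$. Assume that there exists $y_0\in H_2$ such that if $Cx\in\mathrm{rge}(\mathcal F^{-1}+D)$, then $\big(y_0+\mathrm{rge}(D+D^T)\big)\cap(\mathcal F^{-1}+D)^{-1}(Cx)\ne\emptyset$. Put $\mathcal B:=(\mathcal F^{-1}+D)^{-1}$, $G:=C^T\mathcal B C$ and $\mathcal H:=Pf+PB(\mathcal F^{-1}+D)^{-1}C$. Let $(x_n)$ be the sequence generated by Algorithm 2, that is: for some small $\gamma>0$, compute $J_{\gamma\mathcal B}$, $J_{\gamma G}$ and then $J_{\gamma\mathcal H}$, and, given $x_0\in H_1$, set $$x_{n+1}=J_{\gamma\mathcal H}(x_n),\qquad n\ge 0.$$ Then $(x_n)$ converges weakly to an equilibrium point $x^*$ of the set-valued Lur'e system.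
   Context: The set-valued Lur'e system is: $\dot x(t)=-f(x(t))+B\lambda(t)$ for a.e. $t\ge 0$, $y(t)=Cx(t)+D\lambda(t)$, $\lambda(t)\in-\mathcal F(y(t))$ for $t\ge 0$, $x(0)=x_0$. It is equivalent to $\dot x\in -f(x)-B(\mathcal F^{-1}+D)^{-1}(Cx)$, $x(0)=x_0$, and an equilibrium is a point $x^*$ with $0\in f(x^* )+B(\mathcal F^{-1}+D)^{-1}(Cx^* )$. The system $(f,B,C,D)$ is $P$-passive if for all $x_1,x_2\in H_1$ and $y_1,y_2\in H_2$, $$\langle P(f(x_1)-f(x_2)),x_1-x_2\rangle+\langle (PB-C^T)(y_1-y_2),x_1-x_2\rangle+\langle D(y_1-y_2),y_1-y_2\rangle\ge 0.$$ A bounded linear operator $E$ is positive definite if there is $c>0$ with $\langle Ex,x\rangle\ge c\|x\|^2$ for all $x$, and semi-coercive if there is $c>0$ with $\langle Ex,x\rangle\ge c\|x\|^2$ for all $x\in\mathrm{rge}(E+E^T)$; $E^T$ denotes the transpose (adjoint) of $E$. For a set-valued map $\mathcal F:H\rightrightarrows H$ on a Hilbert space $H$: $\mathrm{rge}(\mathcal F)=\bigcup_{x\in H}\mathcal F(x)$; $\mathcal F^{-1}(y)=\{x\in H: y\in\mathcal F(x)\}$; $\mathcal F$ is monotone if $\langle x^*-y^*,x-y\rangle\ge 0$ for all $x,y\in H$, $x^*\in\mathcal F(x)$, $y^*\in\mathcal F(y)$, and maximal monotone if moreover its graph is not strictly contained in the graph of another monotone operator. The resolvent of $\mathcal F$ is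 $J_{\mathcal F}=(I+\mathcal F)^{-1}$, where $I$ is the identity. $\mathrm{ri}(S)$ denotes the relative interior of the set $S$.
   Formalization: Weak convergence is stated assuming the system has an equilibrium; without this the claim fails (f=1, B=C=D=0, P=F=I on R: no equilibrium, x_n diverges). The relative interior ri is taken relative to the closed affine hull. *)

(* Defs.v *)
(* MathComp-Analysis; the scalars are an arbitrary [R : realType]. *)
From HB Require Import structures.
From mathcomp Require Import all_boot all_order all_algebra.
From mathcomp Require Import sesquilinear.
From mathcomp Require Import all_classical all_reals all_analysis.

Set Implicit Arguments.
Unset Strict Implicit.
Unset Printing Implicit Defensive.

Import Order.TTheory GRing.Theory Num.Theory.
Import numFieldNormedType.Exports.

Local Open Scope classical_set_scope.
Local Open Scope ring_scope.

(* Real Hilbert spaces, of arbitrary dimension: a complete normed module whose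
   norm comes from a symmetric positive definite bilinear form. *)
HB.mixin Record CompleteNormedModule_isHilbert (R : realType) H
    of CompleteNormedModule R H := {
  inner : {dot H for (@idfun R)} ;
  inner_normE : forall x : H, `|x| ^+ 2 = inner x x }.

#[short(type="hilbertType")]
HB.structure Definition Hilbert (R : realType) :=
  { H of CompleteNormedModule_isHilbert R H & CompleteNormedModule R H }.

Notation "[< u , v >]" := (inner u v)
  (at level 0, u at level 200, v at level 200, format "[<  u ,  v  >]")
  : ring_scope.

Section Operators.
Context {R : realType} {U V : hilbertType R}.

Definition bounded_op (E : U -> V) : Prop :=
  exists M : R, forall x, `|E x| <= M * `|x|.

(* By the Riesz representation theorem the set below is a singleton when [E] is
   a bounded linear operator; the default value 0 is irrelevant then. *)
Definition adjoint (E : U -> V) : V -> U :=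
  fun y => xget 0 [set v : U | forall x : U, [< E x, y >] = [< x, v >]].

Definition weak_cvg (x : nat -> U) (l : U) : Prop :=
  forall h : U, (fun n => [< x n, h >]) @ \oo --> [< l, h >].

End Operators.

Section SelfOperators.
Context {R : realType} {U : hilbertType R}.

Definition symmetric_op (E : U -> U) : Prop :=
  forall x y : U, [< E x, y >] = [< x, E y >].

Definition positive_definite (E : U -> U) : Prop :=
  exists2 c : R, 0 < c & forall x : U, c * `|x| ^+ 2 <= [< E x, x >].

Definition rge_sym (E : U -> U) : set U := range (fun z => E z + adjoint E z).

Definition semi_coercive (E : U -> U) : Prop :=
  exists2 c : R, 0 < c &
    forall x : U, rge_sym E x -> c * `|x| ^+ 2 <= [< E x, x >].

Definition affine_set (A : set U) : Prop :=
  forall (t : R) (x y : U), A x -> A y -> A (t *: x + (1 - t) *: y).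

(* Interior relative to the closed affine hull, the usual convention in
   infinite dimension. *)
Definition relint (S : set U) : set U :=
  [set x | S x /\
     exists2 e : R, 0 < e & ball x e `&` closure (smallest affine_set S) `<=` S].

End SelfOperators.

(* A set-valued map is a function into sets; its domain is where it is
   nonempty, so e.g. [sadd F G x] is empty as soon as [F x] or [G x] is. *)
Section SetValuedMaps.
Context {R : realType} {U V : hilbertType R}.

Definition srge (F : U -> set V) : set V := [set y | exists x, F x y].

Definition sinv (F : U -> set V) : V -> set U := fun y => [set x | F x y].

Definition single (f : U -> V) : U -> set V := fun x => [set f x].

Definition sadd (F G : U -> set V) : U -> set V :=
  fun x => [set a + b | a in F x & b in G x].

Definition sscale (g : R) (F : U -> set V) : U -> set V :=
  fun x => [set g *: a | a in F x].

End SetValuedMaps.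

Section MonotoneOperators.
Context {R : realType} {U : hilbertType R}.

Definition monotone_op (F : U -> set U) : Prop :=
  forall x y u v : U, F x u -> F y v -> 0 <= [< u - v, x - y >].

Definition maximal_monotone (F : U -> set U) : Prop :=
  monotone_op F /\
  forall G : U -> set U, monotone_op G ->
    (forall x, F x `<=` G x) -> (forall x, G x `<=` F x).

Definition resolvent (F : U -> set U) : U -> set U :=
  sinv (sadd (single id) F).

(* The resolvent of [F] is single-valued and everywhere defined, equal to [J]. *)
Definition is_resolvent (F : U -> set U) (J : U -> U) : Prop :=
  forall z, resolvent F z = [set J z].

End MonotoneOperators.

Section Lure.
Context {R : realType} {H1 H2 : hilbertType R}.
Implicit Types (f P : H1 -> H1) (B : H2 -> H1) (C : H1 -> H2) (D : H2 -> H2).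
Implicit Types (F : H2 -> set H2).

Definition passive P f B C D : Prop :=
  forall (x1 x2 : H1) (y1 y2 : H2),
    0 <= [< P (f x1 - f x2), x1 - x2 >]
       + [< P (B (y1 - y2)) - adjoint C (y1 - y2), x1 - x2 >]
       + [< D (y1 - y2), y1 - y2 >].

Definition finvD F D : H2 -> set H2 := sadd (sinv F) (single D).

Definition lureB F D : H2 -> set H2 := sinv (finvD F D).

Definition lureG C F D : H1 -> set H1 :=
  fun x => [set adjoint C y | y in lureB F D (C x)].

Definition lureH P f B C D F : H1 -> set H1 :=
  sadd (single (P \o f)) (fun x => [set P (B y) | y in lureB F D (C x)]).

Definition equilibrium f B C D F : set H1 :=
  [set x | sadd (single f) (fun x => [set B y | y in lureB F D (C x)]) x 0].

End Lure.

(* Main.v *)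
Require Import Defs.
From HB Require Import structures.
From mathcomp Require Import all_boot all_order all_algebra.
From mathcomp Require Import sesquilinear.
From mathcomp Require Import all_classical all_reals all_analysis.
From mathcomp Require Import ring lra.
Import Order.TTheory GRing.Theory Num.Theory.
Import numFieldNormedType.Exports.
Local Open Scope classical_set_scope.
Local Open Scope ring_scope.

Set Implicit Arguments.
Unset Strict Implicit.
Unset Printing Implicit Defensive.

(* Writing [y] for an element of [(F^-1 + D)^-1 (C x)], passivity forces
   [P B = C^T] on differences of two such [y], while semi-coercivity of [D] and
   the point [y0] provide a selection [Y x] that is Lipschitz in [x].  Hence
   [PB (F^-1 + D)^-1 C = G + (PB - C^T) Y], the operator [H] of the algorithm is
   monotone and a Lipschitz perturbation of [G = C^T (F^-1 + D)^-1 C], and its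
   resolvent is obtained from the one of [G] by a contraction for small steps.

   The resolvent equation of [G] becomes [C z \in F^-1 y + (g C C^T + D) y].
   Adding [lam y] makes it solvable by Minty's theorem, which comes from
   minimizing the Fitzpatrick function plus half the squared norm.  As [lam]
   vanishes the solutions stay bounded, by the interiority condition and the
   uniform boundedness principle, and their weak limit solves the equation by
   maximality of [F].

   The iteration is then the proximal point algorithm for a monotone operator
   with full resolvent: Fejer monotonicity, demiclosedness and Opial's argument
   give weak convergence.  Weak limits are taken along ultrafilters, so that
   weak compactness of balls is just the Riesz theorem applied to limits of
   bounded real families. *)

(** * Algebra of the inner product and the Cauchy-Schwarz inequality *)

Section InnerProduct.
Context {R : realType} {H : hilbertType R}.
Implicit Types x y z : H.

Lemma innerC x y : [< x, y >] = [< y, x >].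
Proof. by rewrite hermC expr0 mul1r. Qed.

Lemma innerDl x y z : [< x + y, z >] = [< x, z >] + [< y, z >].
Proof. exact: linearDl. Qed.

Lemma innerNl x z : [< - x, z >] = - [< x, z >].
Proof. exact: linearNl. Qed.

Lemma innerZl a x z : [< a *: x, z >] = a * [< x, z >].
Proof. exact: linearZl_LR. Qed.

Lemma innerDr x y z : [< z, x + y >] = [< z, x >] + [< z, y >].
Proof. exact: linearDr. Qed.

Lemma innerNr x z : [< z, - x >] = - [< z, x >].
Proof. exact: linearNr. Qed.

Lemma innerZr a x z : [< z, a *: x >] = a * [< z, x >].
Proof. by rewrite innerC innerZl innerC. Qed.

Lemma inner0l x : [< 0, x >] = 0.
Proof. by rewrite -(scale0r x) innerZl mul0r. Qed.

Lemma inner0r x : [< x, 0 >] = 0.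
Proof. by rewrite innerC inner0l. Qed.

Definition innerE :=
  (@inner_normE R H, innerDl, innerDr, innerNl, innerNr, innerZl, innerZr, inner0l,
   inner0r).

Lemma inner_ge0 x : 0 <= [< x, x >].
Proof. by rewrite -inner_normE sqr_ge0. Qed.

Lemma inner_le0_eq0 x : [< x, x >] <= 0 -> x = 0.
Proof.
rewrite -inner_normE => x0; apply/normr0_eq0/eqP; rewrite -sqrf_eq0.
by rewrite eq_le x0 sqr_ge0.
Qed.

Lemma inner_inj x y : (forall z, [< z, x >] = [< z, y >]) -> x = y.
Proof.
move=> xy; apply/eqP; rewrite -subr_eq0; apply/eqP/inner_le0_eq0.
by rewrite innerDr innerNr xy subrr.
Qed.

Lemma cauchy_schwarz x y : `|[< x, y >]| <= `|x| * `|y|.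
Proof.
rewrite -ler_sqr ?nnegrE ?mulr_ge0// real_normK ?num_real// exprMn.
have [->|x0] := eqVneq x 0; first by rewrite inner0l normr0 !expr0n/= mul0r.
have := inner_ge0 ([< x, x >] *: y - [< x, y >] *: x).
have xx : 0 < [< x, x >] by rewrite -inner_normE exprn_gt0// normr_gt0.
rewrite !innerE (innerC y x) => h.
rewrite -subr_ge0 -(pmulr_rge0 _ xx); apply: le_trans h _.
by rewrite le_eqVlt; apply/orP; left; apply/eqP; ring.
Qed.

Lemma inner_le x y : [< x, y >] <= `|x| * `|y|.
Proof. exact: le_trans (ler_norm _) (cauchy_schwarz x y). Qed.

End InnerProduct.

(** * Minimization of uniformly convex energies on a product of Hilbert spaces *)

Section Minimization.
Context {R : realType} {U V : hilbertType R}.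

(* [L p q r] reads "the energy at [(p, q)] is at most [r]". *)
Lemma uniformly_convex_min (L : U -> V -> R -> Prop) (k lb : R) : 0 < k ->
  (exists p q r, L p q r) ->
  (forall p q r, L p q r -> lb <= r) ->
  (forall p q r p' q' r', L p q r -> L p' q' r' ->
     L (2^-1 *: (p + p')) (2^-1 *: (q + q'))
       ((r + r') / 2 - k * (`|p - p'| ^+ 2 + `|q - q'| ^+ 2))) ->
  (forall p q m, (forall e, 0 < e -> exists p' q' r',
     [/\ `|p - p'| < e, `|q - q'| < e, r' < m + e & L p' q' r']) -> L p q m) ->
  exists p q m, L p q m /\ forall p' q' r', L p' q' r' -> m <= r'.
Proof.
move=> k0 [p0 [q0 [r0 L0]]] Llb Lmid Lclosed.
pose E := [set r | exists p q, L p q r].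
have hinf : has_inf E.
  split; first by exists r0, p0, q0.
  by exists lb => r [p [q]]; exact: Llb.
have infE r : E r -> inf E <= r by move=> Er; apply: ge_inf => //; case: hinf.
have sub n : exists t : U * V * R,
    L t.1.1 t.1.2 t.2 /\ t.2 < inf E + n.+1%:R^-1.
  have [|r [p [q Lr]] rlt] := @inf_adherent _ E n.+1%:R^-1 _ hinf.
    by rewrite invr_gt0.
  by exists (p, q, r).
have [s hs] := choice sub.
(* The midpoint of two near-minimizers has energy at least [inf E], so the convexity gain bounds
   their distance and the minimizing sequence is Cauchy. *)
have smid n j : k * (`|(s n).1.1 - (s j).1.1| ^+ 2 + `|(s n).1.2 - (s j).1.2| ^+ 2)
    <= (n.+1%:R^-1 + j.+1%:R^-1) / 2.
  have [Ln ln] := hs n; have [Lj lj] := hs j.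
  have := infE _ (ex_intro _ _ (ex_intro _ _ (Lmid _ _ _ _ _ _ Ln Lj))).
  move: ln lj; set a := n.+1%:R^-1; set b := j.+1%:R^-1.
  set c := k * _; lra.
have close e : 0 < e -> \forall n & j \near \oo,
    `|(s n).1.1 - (s j).1.1| < e /\ `|(s n).1.2 - (s j).1.2| < e.
  move=> e0.
  have ke : 0 < k * e ^+ 2 by rewrite mulr_gt0// exprn_gt0.
  have small : \forall n \near \oo, n.+1%:R^-1 < k * e ^+ 2.
    exact: (near_infty_natSinv_lt (PosNum ke)).
  near=> n j.
  have : (n.+1%:R^-1 + j.+1%:R^-1) / 2 < k * e ^+ 2.
    have : n.+1%:R^-1 < k * e ^+ 2 by near: n; exact: small.
    have : j.+1%:R^-1 < k * e ^+ 2 by near: j; exact: small.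
    by set a := n.+1%:R^-1; set b := j.+1%:R^-1; lra.
  move=> /(le_lt_trans (smid n j)); rewrite ltr_pM2l// => sq.
  have := sqr_ge0 `|(s n).1.1 - (s j).1.1|.
  have := sqr_ge0 `|(s n).1.2 - (s j).1.2| => h1 h2.
  by split; rewrite -ltr_sqr ?nnegrE// ?(ltW e0)//; lra.
have /cauchy_cvgP cvp : cauchy (((fun n => (s n).1.1) : nat -> U) @ \oo).
  apply/cauchy_ballP => e e0; near_simpl; have := close e e0.
  by apply: filterS => -[n j] [+ _]; rewrite -ball_normE.
have /cauchy_cvgP cvq : cauchy (((fun n => (s n).1.2) : nat -> V) @ \oo).
  apply/cauchy_ballP => e e0; near_simpl; have := close e e0.
  by apply: filterS => -[n j] [_ +]; rewrite -ball_normE.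
exists (lim ((fun n => (s n).1.1) @ \oo)), (lim ((fun n => (s n).1.2) @ \oo)).
exists (inf E); split; last by move=> p q r Lr; apply: infE; exists p, q.
apply: Lclosed => e e0; near \oo => n.
exists (s n).1.1, (s n).1.2, (s n).2; split; last exact: (hs n).1.
- by near: n; move/cvgrPdist_lt: cvp => /(_ _ e0).
- by near: n; move/cvgrPdist_lt: cvq => /(_ _ e0).
- apply: lt_trans (hs n).2 _; rewrite ltrD2l.
  by near: n; exact: (near_infty_natSinv_lt (PosNum e0)).
Unshelve. all: by end_near. Qed.

End Minimization.

(** * Elementary real inequalities *)

Section RealLemmas.
Context {R : realType}.
Implicit Types a b c : R.

Lemma le_vanishing a b c : 0 <= c ->
  (forall e, 0 < e -> e <= 1 -> a <= b + e * c) -> a <= b.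
Proof.
move=> c0 abe; rewrite leNgt; apply/negP => ba.
pose e := Num.min 1 ((a - b) / (2 * (c + 1))).
have c1 : 0 < c + 1 by rewrite ltr_wpDl.
have e0 : 0 < e by rewrite lt_min ltr01 divr_gt0 ?subr_gt0// mulr_gt0.
have := abe e e0; rewrite ge_min lexx => /(_ isT).
have : e * (2 * (c + 1)) <= a - b.
  by rewrite -ler_pdivlMr ?mulr_gt0// ge_min lexx orbT.
by nra.
Qed.

(** First-order condition at a one-sided minimum: after division by [t] the quadratic term vanishes
    with [t]. *)
Lemma slope_ge0 a b : (forall t, 0 < t -> t <= 1 -> 0 <= t * a + t ^+ 2 * b) ->
  0 <= a.
Proof.
move=> h; apply: (@le_vanishing _ _ `|b|) => // t t0 t1.
have := h t t0 t1; rewrite expr2 -mulrA -mulrDr pmulr_rge0// => /le_trans.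
by apply; rewrite lerD2l ler_wpM2l ?ler_norm// ltW.
Qed.

Lemma slope_eq0 a b : (forall t, 0 <= t * a + t ^+ 2 * b) -> a = 0.
Proof.
move=> h; apply/eqP; rewrite eq_le -oppr_ge0; apply/andP; split.
  by apply: (@slope_ge0 _ b) => t _ _; have := h (- t); rewrite sqrrN mulNr mulrN.
by apply: (@slope_ge0 _ b) => t _ _; exact: h.
Qed.

(** Completing the square; it absorbs a term linear in an unbounded distance [s]. *)
Lemma quadratic_lower_bound (g k s : R) : 0 < g ->
  - (g * k ^+ 2 / 4) <= g^-1 * s ^+ 2 - k * s.
Proof.
move=> g0; have := mulr_ge0 (ltW g0) (sqr_ge0 (g^-1 * s - k / 2)).
have -> : g * (g^-1 * s - k / 2) ^+ 2 = g^-1 * s ^+ 2 - k * s + g * k ^+ 2 / 4.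
  by field; rewrite gt_eqF.
by lra.
Qed.

End RealLemmas.

(** * Riesz representation and orthogonal projection *)

Section Riesz.
Context {R : realType} {H : hilbertType R}.

(* The representative of [phi] on [K] minimizes [|p|^2 / 2 - phi p] over [K];
   [phi = [< w, . >]] gives the orthogonal projection of [w] onto [K]. *)
Lemma riesz_subspace (K : set H) (phi : H -> R) (M : R) :
  K 0 -> (forall a x y, K x -> K y -> K (a *: x + y)) -> closed K ->
  (forall a x y, phi (a *: x + y) = a * phi x + phi y) ->
  (forall x, `|phi x| <= M * `|x|) ->
  exists2 v, K v & forall x, K x -> phi x = [< x, v >].
Proof.
move=> K0 Klin Kclosed philin phiM.
have phi0 : phi 0 = 0.
  by have := philin 1 0 0; rewrite scale1r addr0 mul1r; lra.
have phiD x y : phi (x + y) = phi x + phi y.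
  by rewrite -(scale1r x) philin mul1r scale1r.
have phiZ a x : phi (a *: x) = a * phi x.
  by rewrite -(addr0 (a *: x)) philin phi0 addr0.
have KZ a x : K x -> K (a *: x) by move=> Kx; rewrite -(addr0 (a *: x)); exact: Klin.
have KD x y : K x -> K y -> K (x + y).
  by move=> Kx; rewrite -(scale1r x); exact: Klin.
(* The second variable is pinned to 0. The constant 1/8 is the parallelogram identity for half the
   squared norm, and the lower bound is the minimum of [s ^+ 2 / 2 - M * s]. *)
have [|||||p [q [m [[_ [Kp Lp]] mmin]]]] := @uniformly_convex_min R H H
  (fun p q r => q = 0 /\ K p /\ `|p| ^+ 2 / 2 - phi p <= r) 8^-1 (- (M ^+ 2 / 2)).
- by rewrite invr_gt0.
- by exists 0, 0, (`|0 : H| ^+ 2 / 2 - phi 0).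
- move=> p q r [_ [_]]; apply: le_trans.
  have := phiM p; have := ler_norm (phi p); have := sqr_ge0 (`|p| - M).
  by nra.
- move=> p q r p' q' r' [-> [Kp Lp]] [-> [Kp' Lp']].
  rewrite addr0 scaler0; split=> //; split; first exact/KZ/KD.
  move: Lp Lp'; rewrite phiZ phiD subrr normr0 !innerE (innerC p' p).
  by lra.
- move=> p q m h; split.
    apply/eqP; rewrite -normr_le0; apply: (@le_vanishing _ _ _ 1) => // e e0 _.
    have [p' [q' [r' [_ + _ [q'0 _]]]]] := h e e0.
    by rewrite q'0 subr0 add0r mulr1 => /ltW.
  split.
    apply: Kclosed => B /nbhs_ballP[e /= e0 eB].
    have [p' [q' [r' [pp' _ _ [_ [Kp' _]]]]]] := h e e0.
    by exists p'; split => //; apply: eB; rewrite -ball_normE.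
  apply: (@le_vanishing _ _ _ (1 + `|p| + `|M|)); first by rewrite !addr_ge0.
  move=> e e0 _; have [p' [q' [r' [pp' _ rm [_ [_ Lp']]]]]] := h e e0.
  have -> : phi p = phi p' + phi (p - p') by rewrite -phiD addrC subrK.
  have := phiM (p - p'); have := ler_norm (- phi (p - p')); rewrite normrN.
  have := inner_le (p - p') p.
  have := sqr_ge0 `|p - p'|.
  have : `|p - p'| * `|p| <= e * `|p| by rewrite ler_wpM2r// ltW.
  have : M * `|p - p'| <= `|M| * e.
    by rewrite (le_trans (ler_wpM2r _ (ler_norm M)))// ler_wpM2l// ltW.
  move: Lp'; rewrite !innerE (innerC p' p).
  by lra.
exists p => // x Kx; apply/eqP; rewrite eq_sym -subr_eq0; apply/eqP.
(* Euler-Lagrange equation: [p] is minimal along the whole line [p + t *: x], so the derivative in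
   direction [x] vanishes. *)
apply: (@slope_eq0 _ _ (`|x| ^+ 2 / 2)) => t.
have := mmin (p + t *: x) 0 _ (conj erefl (conj (KD _ _ Kp (KZ t _ Kx)) (lexx _))).
move: Lp; rewrite phiD phiZ !innerE (innerC p x).
by lra.
Qed.

Lemma riesz (phi : H -> R) (M : R) :
  (forall a x y, phi (a *: x + y) = a * phi x + phi y) ->
  (forall x, `|phi x| <= M * `|x|) ->
  exists v, forall x, phi x = [< x, v >].
Proof.
move=> philin phiM.
have [|v _ hv] := @riesz_subspace setT phi M Logic.I _ closedT philin phiM.
  by [].
by exists v => x; exact: hv.
Qed.

Lemma orthogonal_projection (K : set H) w :
  K 0 -> (forall a x y, K x -> K y -> K (a *: x + y)) -> closed K ->
  exists2 v, K v & forall x, K x -> [< x, w >] = [< x, v >].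
Proof.
move=> K0 Klin Kc; apply: (@riesz_subspace K (fun x => [< x, w >]) `|w|) => //.
  by move=> a x y; rewrite innerDl innerZl.
by move=> x; rewrite mulrC; exact: cauchy_schwarz.
Qed.

End Riesz.

(** * Fixed points of contractions *)

Section FixedPoint.
Context {R : realType} {X : completeNormedModType R}.

Lemma contraction_fixpoint (phi : X -> X) (q : R) : 0 <= q -> q < 1 ->
  (forall x y, `|phi x - phi y| <= q * `|x - y|) -> exists p, phi p = p.
Proof.
move=> q0 q1 hphi.
pose F : {fun [set: X] >-> [set: X]} :=
  HB.pack phi (isFun.Build _ _ setT setT phi (fun _ _ => Logic.I)).
have [|||p _ pE] := @banach_fixed_point R X setT F.
- exists (NngNum q0); split => //= -[x y] _ /=; exact: hphi.
- exact: closedT.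
- by exists 0.
- by exists p.
Qed.

End FixedPoint.

(** * Minty's theorem through the Fitzpatrick function *)

Section Minty.
Context {R : realType} {H : hilbertType R}.
Implicit Types A F : H -> set H.

(** Pointwise form of maximality, free of any quantification over operators. *)
Definition maximally_related A : Prop :=
  forall p u, (forall a b, A a b -> 0 <= [< u - b, p - a >]) -> A p u.

(** Adding the single pair [(p, u)] to the graph keeps it monotone, so maximality already contains
    that pair. *)
Lemma maximal_monotone_related F : maximal_monotone F -> maximally_related F.
Proof.
move=> [Fmon Fmax] p u hpu.
apply: (Fmax (fun x => F x `|` [set v | x = p /\ v = u])); last by right.
  move=> x y v w [Fv|[-> ->]] [Fw|[-> ->]]; first exact: Fmon.
  - by have := hpu _ _ Fv; rewrite -opprB innerNl -innerNr opprB.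
  - exact: hpu.
  - by rewrite !subrr inner0l.
by move=> x v; left.
Qed.

Lemma maximally_related_neq0 A : maximally_related A -> exists a b, A a b.
Proof.
move=> Amax; apply: contrapT => A0; apply: (A0).
by exists 0, 0; apply: Amax => a b Aab; case: A0; exists a, b.
Qed.

(** If [(p, u)] is outside the graph, some [(a, b)] violates monotonicity against it, and expanding
    that violation gives the bound. A witness replaces the supremum, which may be infinite. *)
Lemma fitzpatrick_ge A p u : maximally_related A ->
  exists a b, A a b /\ [< p, u >] <= [< p, b >] + [< a, u >] - [< a, b >].
Proof.
move=> Amax; have [Apu|nApu] := pselect (A p u).
  by exists p, u; split=> //; rewrite addrK.
apply: contrapT => h; apply: nApu; apply: Amax => a b Aab.
rewrite leNgt; apply/negP => neg; apply: h; exists a, b; split=> //.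
move: neg; rewrite !innerE (innerC u p) (innerC b p) (innerC u a) (innerC b a).
by lra.
Qed.

(* Simons-Zalinescu: minimize the Fitzpatrick function of [A] plus half the
   squared norm of [H * H]. *)
Lemma minty0 A : monotone_op A -> maximally_related A -> exists p, A p (- p).
Proof.
move=> Amon Amax.
(* The energy is given by its epigraph: [r] bounds every affine piece of the Fitzpatrick function
   plus the norms. It is at least 0 because that function dominates the pairing. *)
have [|||||x [u [m [Lm mmin]]]] := @uniformly_convex_min R H H
  (fun x u r => forall a b, A a b ->
    [< x, b >] + [< a, u >] - [< a, b >] + `|x| ^+ 2 / 2 + `|u| ^+ 2 / 2 <= r)
  8^-1 0.
- by rewrite invr_gt0.
- have [a [b Aab]] := maximally_related_neq0 Amax.
  exists a, b, ([< a, b >] + `|a| ^+ 2 / 2 + `|b| ^+ 2 / 2) => a' b' Aab'.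
  have := Amon _ _ _ _ Aab Aab'; rewrite !innerE.
  rewrite (innerC b a) (innerC b' a) (innerC b a') (innerC b' a').
  by lra.
- move=> x u r L; have [a [b [Aab]]] := fitzpatrick_ge x u Amax.
  have := inner_ge0 (x + u).
  by have := L a b Aab; rewrite !innerE (innerC u x); lra.
- move=> p q r p' q' r' L L' a b Aab.
  have := L a b Aab; have := L' a b Aab.
  rewrite !innerE (innerC p' p) (innerC q' q).
  by lra.
- move=> p q m h a b Aab.
  apply: (@le_vanishing _ _ _ (1 + `|b| + `|a| + `|p| + `|q|)).
    by rewrite !addr_ge0.
  move=> e e0 _; have [p' [q' [r' [pp' qq' rm L]]]] := h e e0.
  have := L a b Aab.
  have : [< p - p', b >] <= e * `|b|.
    by rewrite (le_trans (inner_le _ _))// ler_wpM2r// ltW.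
  have : [< p - p', p >] <= e * `|p|.
    by rewrite (le_trans (inner_le _ _))// ler_wpM2r// ltW.
  have : [< q - q', q >] <= e * `|q|.
    by rewrite (le_trans (inner_le _ _))// ler_wpM2r// ltW.
  have : [< q - q', a >] <= e * `|a|.
    by rewrite (le_trans (inner_le _ _))// ler_wpM2r// ltW.
  have := inner_ge0 (p - p'); have := inner_ge0 (q - q').
  rewrite !innerE (innerC p' p) (innerC q' q) (innerC q a) (innerC q' a).
  by lra.
have key a b : A a b -> 0 <= [< a + u, b + x >] - `|x + u| ^+ 2.
  move=> Aab.
  have : 0 <= [< a, b >] + [< x, a >] + [< u, b >] - m
              - `|x| ^+ 2 / 2 - `|u| ^+ 2 / 2.
    apply: (@slope_ge0 _ _ ((`|a - x| ^+ 2 + `|b - u| ^+ 2) / 2)) => t t0 t1.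
    rewrite -subr_ge0 in t1.
    (* By convexity [r] bounds the energy at a point of the segment from [(x, u)] to [(a, b)]; on
       the graph the Fitzpatrick function is at most [[< a, b >]]. *)
    pose r := (1 - t) * (m - `|x| ^+ 2 / 2 - `|u| ^+ 2 / 2) + t * [< a, b >]
      + `|x + t *: (a - x)| ^+ 2 / 2 + `|u + t *: (b - u)| ^+ 2 / 2.
    have : m <= r.
      apply: (mmin (x + t *: (a - x)) (u + t *: (b - u))) => a' b' Aab'.
      have := Amon _ _ _ _ Aab Aab' => /(mulr_ge0 (ltW t0)).
      have : 0 <= m - ([< x, b' >] + [< a', u >] - [< a', b' >]
                       + `|x| ^+ 2 / 2 + `|u| ^+ 2 / 2).
        by rewrite subr_ge0; exact: Lm.
      move=> /(mulr_ge0 t1).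
      rewrite /r !innerE (innerC b a) (innerC b' a) (innerC b a') (innerC b' a').
      by lra.
    rewrite /r !innerE (innerC a x) (innerC b u).
    by lra.
  have [a' [b' [Aab' h']]] := fitzpatrick_ge x u Amax.
  have := Lm _ _ Aab'; move: h'; rewrite !innerE (innerC u x) (innerC a x).
  by lra.
(* By [key] this pair is monotonically related to the graph; [key] applied to it then forces
   [x + u = 0]. *)
have Aux : A (- u) (- x).
  apply: Amax => a b /key; have := sqr_ge0 `|x + u|.
  rewrite !innerE (innerC b u) (innerC b a) (innerC x a) (innerC u x).
  by lra.
have := key _ _ Aux; rewrite addNr inner0l sub0r inner_normE oppr_ge0.
move=> /inner_le0_eq0/eqP; rewrite addr_eq0 => /eqP xu.
by exists x; rewrite {1}xu.
Qed.

(** Translating and scaling the values of [A] preserves both hypotheses and reduces the inclusion to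
    [minty0]. *)
Lemma minty A (mu : R) (z : H) : monotone_op A -> maximally_related A -> 0 < mu ->
  exists p, A p (mu^-1 *: (z - p)).
Proof.
move=> Amon Amax mu0.
pose A' (p : H) : set H := [set u : H | A p (mu^-1 *: (z + u))].
suff [p] : exists p, A' p (- p) by exists p.
apply: minty0.
  move=> x y u v Au Av.
  have := Amon _ _ (mu^-1 *: (z + u)) (mu^-1 *: (z + v)) Au Av.
  by rewrite -scalerBr opprD addrACA subrr add0r innerZl pmulr_rge0 ?invr_gt0.
move=> p u h; apply: Amax => a b Aab.
have := h a (mu *: b - z).
rewrite /A' /= addrCA subrr addr0 scalerA mulVf ?gt_eqF// scale1r => /(_ Aab).
have -> : u - (mu *: b - z) = mu *: (mu^-1 *: (z + u) - b).
  by rewrite scalerBr scalerA divff ?gt_eqF// scale1r opprB addrA (addrC u).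
by rewrite innerZl pmulr_rge0.
Qed.

(* [y] is a fixed point of the resolvent of [mu A] applied to a forward step
   along [T + lam], which is a contraction for small [mu]. *)
Lemma minty_linear A (T : {linear H -> H}) (lam : R) (z : H) :
  monotone_op A -> maximally_related A ->
  bounded_op T -> (forall x, 0 <= [< T x, x >]) -> 0 < lam ->
  exists y, A y (z - T y - lam *: y).
Proof.
move=> Amon Amax [K0 TK0] Tmon lam0.
pose K := `|K0| + lam + 1.
have K_gt0 : 0 < K by rewrite /K addr_gt0// ltr_wpDl.
pose S y := T y + lam *: y.
have SB x y : S x - S y = S (x - y).
  by rewrite /S linearB scalerBr opprD addrACA.
have SK x : `|S x| <= K * `|x|.
  rewrite (le_trans (ler_normD _ _))// normrZ (gtr0_norm lam0) /K !mulrDl.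
  rewrite -[leLHS]addr0 lerD ?mulr_ge0// lerD2r (le_trans (TK0 x))//.
  by rewrite ler_wpM2r// ler_norm.
have Slam x : lam * `|x| ^+ 2 <= [< S x, x >].
  by rewrite /S innerDl innerZl inner_normE lerDr.
(* [S] is [lam]-strongly monotone and [K]-Lipschitz; this [mu] minimizes the factor
   [1 - 2 * mu * lam + mu ^+ 2 * K ^+ 2] of the squared distances, with value
   [1 - (lam / K) ^+ 2]. *)
pose mu := lam / K ^+ 2.
have mu0 : 0 < mu by rewrite divr_gt0// exprn_gt0.
have [J hJ] := choice (fun w => minty w Amon Amax mu0).
have Jne w w' : `|J w - J w'| <= `|w - w'|.
  have [->|neq] := eqVneq (J w) (J w'); first by rewrite subrr normr0.
  have n0 : 0 < `|J w - J w'| by rewrite normr_gt0 subr_eq0.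
  have := Amon _ _ _ _ (hJ w) (hJ w').
  rewrite -scalerBr innerZl pmulr_rge0 ?invr_gt0// => h.
  rewrite -(ler_pM2r n0) -expr2 inner_normE.
  apply: le_trans (inner_le (w - w') (J w - J w')).
  by move: h; rewrite !innerE; lra.
pose q := Num.sqrt (1 - (lam / K) ^+ 2).
have lamK : 0 < lam / K by rewrite divr_gt0.
have lamK1 : lam / K <= 1.
  by rewrite ler_pdivrMr// mul1r /K -addrA addrCA lerDl addr_ge0.
have q2 : 0 <= 1 - (lam / K) ^+ 2 by rewrite subr_ge0 expr_le1// ltW.
have q1 : q < 1.
  rewrite -(@sqrtr1 R) ltr_sqrt// ltrBlDr ltrDl exprn_gt0//.
have [|y hy] := @contraction_fixpoint R H (fun y => J (y + mu *: (z - S y))) q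
  (sqrtr_ge0 _) q1.
  move=> x y; apply: le_trans (Jne _ _) _.
  have -> : x + mu *: (z - S x) - (y + mu *: (z - S y)) = (x - y) - mu *: S (x - y).
    rewrite -SB (opprD y) addrACA -scalerBr -scalerN (opprB (S x)).
    by congr (_ + _ *: _); rewrite opprB addrC addrA subrK.
  rewrite -ler_sqr ?nnegrE ?mulr_ge0 ?sqrtr_ge0// exprMn sqr_sqrtr//.
  have muSK : mu ^+ 2 * `|S (x - y)| ^+ 2 <= mu * lam * `|x - y| ^+ 2.
    have -> : mu * lam = mu ^+ 2 * K ^+ 2.
      by rewrite /mu; field; rewrite gt_eqF.
    by rewrite -mulrA ler_pM2l ?exprn_gt0// -exprMn ler_sqr ?nnegrE// mulr_ge0// ltW.
  have := Slam (x - y); rewrite -(ler_pM2l mu0).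
  have -> : (lam / K) ^+ 2 = mu * lam by rewrite /mu; field; rewrite gt_eqF.
  move: muSK; move: (x - y) => d; move: (S d) => s.
  by rewrite !innerE (innerC d s); lra.
exists y; have := hJ (y + mu *: (z - S y)); rewrite hy.
rewrite addrAC subrr add0r scalerA mulVf ?gt_eqF// scale1r.
by rewrite /S opprD addrA.
Qed.

End Minty.

(** * Adjoints of bounded linear operators *)

Section Adjoint.
Context {R : realType} {U V : hilbertType R}.
Implicit Types E : {linear U -> V}.

Lemma bounded_op_gt0 (E : U -> V) : bounded_op E ->
  exists2 K : R, 0 < K & forall x, `|E x| <= K * `|x|.
Proof.
move=> [K EK]; exists (`|K| + 1); first by rewrite ltr_wpDl.
move=> x; apply: le_trans (EK x) _; rewrite ler_wpM2r//.
by rewrite (le_trans (ler_norm K))// lerDl.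
Qed.

(** Riesz applied to [x |-> [< E x, y >]] makes the defining set nonempty, so [xget] never returns
    its default. *)
Lemma adjointP E : bounded_op E ->
  forall x y, [< E x, y >] = [< x, adjoint E y >].
Proof.
move=> [K EK] x y; rewrite /adjoint; case: xgetP => [v _ /= ->//|none].
have [||v hv] := @riesz R U (fun x => [< E x, y >]) (K * `|y|).
- by move=> a x1 x2; rewrite linearP innerDl innerZl.
- move=> x1; rewrite (le_trans (cauchy_schwarz _ _))// mulrAC ler_wpM2r//.
- by case: (none v).
Qed.

Lemma adjoint_linear E : bounded_op E -> linear (adjoint E).
Proof.
move=> Eb a y1 y2; apply: inner_inj => x.
by rewrite -adjointP// innerDr innerZr !adjointP// innerDr innerZr.
Qed.

Lemma adjointB E : bounded_op E -> {morph adjoint E : x y / x - y}.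
Proof.
move=> Eb x y; rewrite addrC -scaleN1r adjoint_linear//.
by rewrite scaleN1r addrC.
Qed.

Lemma adjointZ E a : bounded_op E -> {morph adjoint E : x / a *: x}.
Proof.
move=> Eb x; apply: inner_inj => y.
by rewrite -adjointP// !innerZr adjointP.
Qed.

Lemma bounded_adjoint E : bounded_op E -> bounded_op (adjoint E).
Proof.
move=> Eb; have [K K0 EK] := bounded_op_gt0 Eb; exists K => y.
have [->|neq] := eqVneq (adjoint E y) 0; first by rewrite normr0 mulr_ge0// ltW.
have n0 : 0 < `|adjoint E y| by rewrite normr_gt0.
rewrite -(ler_pM2r n0) -expr2 inner_normE -adjointP//.
apply: le_trans (inner_le _ _) _.
by rewrite [leRHS]mulrAC ler_wpM2r// EK.
Qed.

End Adjoint.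

(** * Weak limits along ultrafilters *)

Section WeakUltralimits.
Context {R : realType} {T : Type} {G : set_system T}.

Lemma ultra_fmap {S : Type} (u : T -> S) : UltraFilter G -> UltraFilter (u @ G).
Proof.
move=> GU; split=> [|G' G'F sub]; first exact: fmap_proper_filter.
rewrite predeqE => A; split; last exact: sub.
move=> G'A; have [//|GnA] := in_ultra_setVsetC (u @^-1` A) GU.
have : G' (~` A) by apply: sub; exact: GnA.
by move=> /(filterI G'A); rewrite setICr => /filter_not_empty.
Qed.

Lemma ultra_bounded_cvg (u : T -> R) (K : R) : UltraFilter G ->
  (forall t, `|u t| <= K) -> exists l, `|l| <= K /\ u @ G --> l.
Proof.
move=> GU uK; have := @segment_compact R (- K) K; rewrite compact_ultra.
move=> /(_ (u @ G) (ultra_fmap u GU))[|l [lK ul]].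
  apply: (@filterE _ G) => t.
  by rewrite /= in_itv/= -ler_norml.
by exists l; split=> //; move: lK; rewrite /= in_itv/= -ler_norml.
Qed.

Lemma cvg_ge0 {FG : ProperFilter G} (u : T -> R) (l : R) :
  u @ G --> l -> (forall t, 0 <= u t) -> 0 <= l.
Proof.
move=> ul u0; apply: (@closed_cvg _ _ G _ u [set x | 0 <= x]) ul => //.
exact: filterE.
Qed.

Lemma weak_ultralimit {H : hilbertType R} (x : T -> H) (K : R) :
  UltraFilter G -> (forall t, `|x t| <= K) ->
  exists p, forall h, [< x t, h >] @[t --> G] --> [< p, h >].
Proof.
move=> GU xK.
have ex h : exists l, `|l| <= K * `|h| /\ [< x t, h >] @[t --> G] --> l.
  apply: ultra_bounded_cvg => t; apply: le_trans (cauchy_schwarz _ _) _.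
  by rewrite ler_wpM2r.
have [phi hphi] := choice ex.
have [||p hp] := @riesz R H phi K.
- move=> a h1 h2.
  have lim : [< x t, a *: h1 + h2 >] @[t --> G] --> a * phi h1 + phi h2.
    rewrite (_ : (fun t => _) = fun t => a * [< x t, h1 >] + [< x t, h2 >]).
      by apply: cvgD (hphi h2).2; apply: cvgM (hphi h1).2; exact: cvg_cst.
    by apply/funext => t; rewrite innerDr innerZr.
  exact: (cvg_unique (@Rhausdorff R) (hphi (a *: h1 + h2)).2 lim).
- by move=> h; exact: (hphi h).1.
- by exists p => h; rewrite innerC -hp; exact: (hphi h).2.
Qed.

End WeakUltralimits.

(** * Affine hulls through the origin and their closures *)

Section AffineHull.
Context {R : realType} {H : hilbertType R}.
Implicit Types S : set H.

(** Scaling is an affine combination with 0, and [a *: x + y] is the midpoint of the doubles of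
    [a *: x] and [y]. *)
Lemma affine_hull_linear S : S 0 ->
  let A := smallest affine_set S in
  forall (a : R) (x y : H), A x -> A y -> A (a *: x + y).
Proof.
move=> S0 /= a x y Ax Ay B [Baff SB].
have B0 : B 0 by exact: SB.
have Bx : B x by exact: Ax.
have By : B y by exact: Ay.
have Bax : B (a *: x + a *: x).
  have := Baff (a + a) _ _ Bx B0; rewrite scaler0 addr0 scalerDl; exact.
have Byy : B (y + y).
  have := Baff 2 _ _ By B0; rewrite scaler0 addr0 scaler_nat mulr2n; exact.
have := Baff 2^-1 _ _ Bax Byy.
have -> : 1 - 2^-1 = 2^-1 :> R by lra.
have half (w : H) : 2^-1 *: (w + w) = w.
  rewrite scalerDr -scalerDl (_ : 2^-1 + 2^-1 = 1) ?scale1r//.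
  by lra.
by rewrite !half.
Qed.

Lemma closure_linear S :
  (forall (a : R) (x y : H), S x -> S y -> S (a *: x + y)) ->
  forall (a : R) (x y : H), closure S x -> closure S y -> closure S (a *: x + y).
Proof.
move=> Slin a x y Sx Sy B /nbhs_ballP[e /= e0 eB].
have a1 : 0 < `|a| + 1 by rewrite ltr_wpDl.
have e2 : 0 < e / 2 by rewrite divr_gt0.
have [x' [Sx' xx']] := Sx _ (nbhsx_ballx x (e / 2 / (`|a| + 1))
  (divr_gt0 e2 a1)).
have [y' [Sy' yy']] := Sy _ (nbhsx_ballx y (e / 2) e2).
exists (a *: x' + y'); split; first exact: Slin.
apply: eB; move: xx' yy'; rewrite -!ball_normE /= => xx' yy'.
rewrite opprD addrACA -scalerBr (le_lt_trans (ler_normD _ _))// normrZ.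
rewrite (splitr e) ler_ltD// (@le_trans _ _ ((`|a| + 1) * `|x - x'|))//.
  by rewrite ler_wpM2r// lerDl.
by rewrite mulrC -ler_pdivlMr// ltW.
Qed.

End AffineHull.

(** * Uniform boundedness on a closed subspace *)

Section UniformBoundedness.
Context {R : realType} {H : hilbertType R}.

(** Pairing with [y i] only sees the projection of [w] onto [K], so the family is pointwise bounded
    on all of [H] and Banach-Steinhaus applies. *)
Lemma pointwise_bounded_on_subspace (K : set H) {I : Type} (y : I -> H) :
  K 0 -> (forall (a : R) x1 x2, K x1 -> K x2 -> K (a *: x1 + x2)) -> closed K ->
  (forall i, K (y i)) ->
  (forall w, K w -> exists M, forall i, `|[< y i, w >]| <= M) ->
  exists M, forall i, `|y i| <= M.
Proof.
move=> K0 Klin Kc Ky bnd.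
pose Fam := [set phi : H -> R^o | exists i, phi = fun w => [< y i, w >]].
have [| |M hM] := @Banach_Steinhauss R H R^o Fam _ _ 1.
- move=> _ [i ->]; split; last by move=> a x1 x2; rewrite innerDr innerZr.
  move=> r; exists (`|y i| * r) => x xr.
  by rewrite (le_trans (cauchy_schwarz _ _))// ler_wpM2l.
- move=> w; have [m Km hm] := orthogonal_projection w K0 Klin Kc.
  have [M hM] := bnd m Km.
  by exists M => _ [i ->]; rewrite hm.
exists M => i; have hi := hM _ (ex_intro _ i erefl).
have [yi0|neq] := eqVneq (y i) 0.
  by have := hi 0; rewrite inner0r !normr0 yi0 normr0 => ->.
have n0 : 0 < `|y i| by rewrite normr_gt0.
(* The functional attains its norm at the unit vector along [y i]. *)
have := hi (`|y i|^-1 *: y i).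
rewrite normrZ normfV normr_id mulVf ?gt_eqF// lexx => /(_ isT).
rewrite innerZr -inner_normE expr2 mulrA mulVf ?gt_eqF// mul1r normr_id.
exact.
Qed.

End UniformBoundedness.

(** * Surjectivity for the resolvents of [lureB] and [lureG] *)

Section LureOperators.
Context {R : realType} {U V : hilbertType R}.
Variables (C : {linear U -> V}) (D : {linear V -> V}) (F : V -> set V).
Hypothesis Cb : bounded_op C.
Hypothesis Db : bounded_op D.
Hypothesis Dge0 : forall y, 0 <= [< D y, y >].
Hypothesis Fmon : monotone_op F.
Hypothesis Fmax : maximally_related F.

Lemma lureBE u y : lureB F D u y <-> F (u - D y) y.
Proof.
split=> [[a Fa [_ -> <-]]|Fuy]; first by rewrite addrK.
by exists (u - D y) => //; exists (D y) => //; rewrite subrK.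
Qed.

(** Monotonicity of [F] at the points [u - D y]. The term in [D] is kept: it carries the
    semi-coercivity and the passivity arguments. *)
Lemma lureB_mono u1 u2 y1 y2 : lureB F D u1 y1 -> lureB F D u2 y2 ->
  [< D (y1 - y2), y1 - y2 >] <= [< u1 - u2, y1 - y2 >].
Proof.
move=> /lureBE F1 /lureBE F2; rewrite -subr_ge0 -innerNl -innerDl.
have -> : u1 - u2 - D (y1 - y2) = u1 - D y1 - (u2 - D y2).
  by rewrite linearB !opprB (addrC (D y2) (- u2)) [RHS]addrACA (addrC (D y2)).
by rewrite innerC; exact: Fmon F1 F2.
Qed.

Lemma sinv_mono : monotone_op (sinv F).
Proof. by move=> x y u v Fux Fvy; rewrite innerC; exact: Fmon. Qed.

Lemma sinv_max : maximally_related (sinv F).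
Proof.
by move=> p u h; apply: Fmax => a b Fab; rewrite innerC; exact: h.
Qed.

(** The equation reads [z] in [F^-1 y + D y + g *: y], where [g] itself is the coercive shift of
    [minty_linear]. *)
Lemma lureB_resolvent_surj (g : R) (z : V) : 0 < g -> exists u y,
  lureB F D u y /\ u + g *: y = z.
Proof.
move=> g0; have [y] := minty_linear z sinv_mono sinv_max Db Dge0 g0.
rewrite /sinv/= addrAC => Fy.
by exists (z - g *: y), y; split; [exact/lureBE|rewrite subrK].
Qed.

Let Ct := adjoint C.
Let CtP : forall x y, [< C x, y >] = [< x, Ct y >] := adjointP Cb.
Let domB := srge (finvD F D).
Let S := [set u - v | u in range C & v in domB].

(** [K] is the closed affine hull of [S], a subspace since 0 is in [S]. It contains [C x] and each
    [d] because both are differences of points of [S]. *)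
Lemma relint_ball : relint S 0 -> exists (K : set V) (e : R),
  [/\ 0 < e, K 0, forall (a : R) x y, K x -> K y -> K (a *: x + y), closed K &
   [/\ forall x, K (C x), forall d, domB d -> K d &
    forall w, K w -> `|w| < e -> exists x d, domB d /\ w = C x - d]].
Proof.
move=> [S0 [e e0 ball_S]]; pose A := smallest affine_set S.
have SA : S `<=` closure A.
  by apply: subset_trans (@subset_closure _ A); exact: sub_smallest.
have Klin := closure_linear (affine_hull_linear S0).
have K0 : closure A 0 by exact: SA.
have [_ [x0 _ <-] [d0 domd0 _]] := S0.
have KB x y : closure A x -> closure A y -> closure A (x - y).
  by move=> Kx Ky; rewrite addrC -scaleN1r; exact: Klin.
have KC x : closure A (C x).
  have -> : C x = (C x - d0) - (C 0 - d0).
    by rewrite opprB addrA subrK linear0 subr0.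
  by apply: KB; apply: SA; [exists (C x)|exists (C 0)] => //; exists d0.
exists (closure A), e; split=> //; first exact: closed_closure.
split=> //.
  move=> d domd; have -> : d = C 0 - (C 0 - d) by rewrite opprB addrC subrK.
  by apply: KB => //; apply: SA; exists (C 0) => //; exists d.
move=> w Kw we; have [|_ [x _ <-] [d domd <-]] := ball_S w.
  by split=> //; rewrite -ball_normE /= sub0r normrN.
by exists x, d.
Qed.

(* The solutions [y n] of the regularized inclusions lie in the closed span [K]
   of [S]; testing monotonicity against a decomposition [w = C x - d] bounds
   [n |-> [< y n, w >]] from below for every small [w] in [K]. *)
Lemma lureG_resolvent_surj (g : R) (z : U) : relint S 0 -> 0 < g ->
  exists x y, lureB F D (C x) y /\ x + g *: Ct y = z.
Proof.
move=> /relint_ball[K [e [e0 K0 Klin Kc [KC Kdom Kball]]]] g0.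
have KZ (a : R) x : K x -> K (a *: x).
  by move=> Kx; rewrite -(addr0 (a *: x)); exact: Klin.
have Ctlin : linear Ct := adjoint_linear Cb.
have CZ a u : C (a *: u) = a *: C u by rewrite linearZ.
pose T0 y := g *: C (Ct y) + D y.
have T0lin : linear T0.
  move=> a y1 y2; rewrite /T0 Ctlin !linearP /=.
  by rewrite addrACA !scalerA (mulrC g).
have [T TE] : exists T : {linear V -> V}, forall y, T y = g *: C (Ct y) + D y.
  by exists (HB.pack_for {linear V -> V} T0 (GRing.isLinear.Build _ _ _ _ _ T0lin)).
have Tb : bounded_op T.
  have [c c0 hc] := bounded_op_gt0 Cb.
  have [ct ct0 hct] := bounded_op_gt0 (bounded_adjoint Cb).
  have [dd dd0 hd] := bounded_op_gt0 Db.
  exists (g * (c * ct) + dd) => y; rewrite TE mulrDl.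
  rewrite (le_trans (ler_normD _ _))// lerD// normrZ gtr0_norm// -!mulrA.
  by rewrite ler_pM2l// (le_trans (hc _))// ler_pM2l.
have Tge0 y : 0 <= [< T y, y >].
  by rewrite TE innerDl innerZl CtP addr_ge0// mulr_ge0 ?inner_ge0// ltW.
pose lam n : R := n.+1%:R^-1.
have lam0 n : 0 < lam n by rewrite invr_gt0.
have lam1 n : lam n <= 1 by rewrite invf_le1// ler1n.
have [y hy] := choice (fun n =>
  minty_linear (C z) sinv_mono sinv_max Tb Tge0 (lam0 n)).
pose x n := z - g *: Ct (y n).
pose d n := C (x n) - lam n *: y n.
have dy n : lureB F D (d n) (y n).
  apply/lureBE; have : F (C z - T (y n) - lam n *: y n) (y n) := hy n.
  rewrite /d /x TE (linearB C) CZ.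
  by rewrite opprD addrA (addrAC _ (- D _)).
have Ky n : K (y n).
  have -> : y n = (lam n)^-1 *: (C (x n) - d n).
    by rewrite opprB addrC subrK scalerA mulVf ?gt_eqF// scale1r.
  apply: (KZ); rewrite addrC -scaleN1r; apply: Klin => //.
  by apply: Kdom; exists (y n); exact: dy.
have low w : K w -> `|w| < e -> exists M, forall n, - M <= [< y n, w >].
  move=> Kw we; have [x' [d' [[v dv] wE]]] := Kball w Kw we.
  have [c c0 hc] := bounded_op_gt0 Cb.
  (* [k] gathers the coefficients of the distance [s] from [x n] to [x'] in [h1] and [h2];
     [- g^-1 * s ^+ 2] absorbs this linear growth. *)
  pose k := c * `|v| + g^-1 * `|z - x'|.
  exists (- [< v, w >] + `|v| ^+ 2 / 4 + g * k ^+ 2 / 4) => n.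
  have mono := le_trans (Dge0 _) (lureB_mono (dy n) dv).
  have dE : d n - d' = C (x n - x') - lam n *: y n + w.
    have -> : d' = C x' - w by rewrite wE opprB addrC subrK.
    by rewrite /d (linearB C (x n) x') opprB (addrC w) addrA (addrAC (C (x n))).
  pose s := `|x n - x'|.
  have h1 : [< y n, C (x n - x') >] <= g^-1 * (`|z - x'| * s) - g^-1 * s ^+ 2.
    have CtE : Ct (y n) = g^-1 *: ((z - x') - (x n - x')).
      rewrite /x opprB addrA subrK opprB addrC subrK.
      by rewrite scalerA mulVf ?gt_eqF// scale1r.
    rewrite innerC CtP innerC CtE innerZl innerDl innerNl -inner_normE mulrBr.
    by rewrite lerB// ler_pM2l ?invr_gt0// inner_le.
  have h2 : - (c * `|v| * s) <= [< v, C (x n - x') >].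
    have := cauchy_schwarz v (C (x n - x')).
    have : `|v| * `|C (x n - x')| <= `|v| * (c * s) by rewrite ler_wpM2l.
    by move=> l1 /le_trans /(_ l1); rewrite ler_norml => /andP[+ _]; lra.
  have h3 := quadratic_lower_bound k s g0.
  have h4 : 0 <= lam n * `|y n - 2^-1 *: v| ^+ 2 by rewrite mulr_ge0// ltW.
  have h5 : 0 <= (1 - lam n) * `|v| ^+ 2 by rewrite mulr_ge0// subr_ge0.
  move: mono h1 h2 h3 h4 h5; rewrite dE /k.
  rewrite [`|y n - _| ^+ 2]inner_normE.
  rewrite !(innerDl, innerDr, innerNl, innerNr, innerZl, innerZr).
  rewrite -!inner_normE.
  rewrite (innerC (C (x n - x')) v) (innerC (C (x n - x')) (y n)).
  rewrite (innerC v (y n)) (innerC w v) (innerC w (y n)).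
  lra.
have bnd w : K w -> exists M, forall n, `|[< y n, w >]| <= M.
  (* Rescaling puts both [t *: w] and its opposite in the small ball, so the lower bounds become
     two-sided. *)
  move=> Kw; pose t := e / (2 * (`|w| + 1)).
  have w1 : 0 < 2 * (`|w| + 1) by rewrite mulr_gt0// ltr_wpDl.
  have t0 : 0 < t by rewrite divr_gt0.
  have tw : `|t *: w| < e.
    rewrite normrZ gtr0_norm// /t mulrAC ltr_pdivrMr// ltr_pM2l//.
    by have := normr_ge0 w; lra.
  have [M1 h1] := low _ (KZ t _ Kw) tw.
  have [||M2 h2] := low (- (t *: w)); rewrite ?normrN//.
    by rewrite -scaleNr; exact: KZ.
  exists (t^-1 * (`|M1| + `|M2|)) => n; rewrite ler_pdivlMl//.
  rewrite -[X in X * _]gtr0_norm// -normrM -innerZr ler_norml.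
  have := h1 n; have := h2 n; rewrite innerNr => {}h2 {}h1.
  have := ler_norm M1; have := ler_norm M2.
  have := normr_ge0 M1; have := normr_ge0 M2.
  by move=> *; apply/andP; split; lra.
have [M hM] := pointwise_bounded_on_subspace K0 Klin Kc Ky bnd.
have [G [GU Goo]] := @ultraFilterLemma nat \oo _.
have [p hp] := weak_ultralimit GU hM.
exists (z - g *: Ct p), p; split; last by rewrite subrK.
apply/lureBE; apply: Fmax => a b Fab.
have -> : C (z - g *: Ct p) - D p = C z - T p.
  by rewrite TE (linearB C) CZ opprD addrA.
pose Tt := adjoint T; have TtP := adjointP Tb.
(* [[< T (y n), y n >]] need not converge along weak limits; positivity of [T] at [y n - p] replaces
   it by its linearization at [p]. What remains is affine in [y n], with linear part [h] and
   constant [c]. *)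
pose h := C z - a - Tt p - T p + Tt b.
pose c := [< p, T p >] - [< b, C z - a >].
have lim : [< y n, h >] + c + lam n * (`|b| * M) @[n --> G] --> [< p, h >] + c + 0.
  apply: cvgD.
    by apply: cvgD; [exact: hp|exact: cvg_cst].
  rewrite -[X in _ --> X](mul0r (`|b| * M)); apply: cvgM; last exact: cvg_cst.
  by apply: cvg_trans (@cvg_harmonic R); apply: cvg_app.
have TtE u v : [< u, Tt v >] = [< v, T u >] by rewrite -TtP innerC.
have <- : [< p, h >] + c + 0 = [< p - b, C z - T p - a >].
  rewrite /h /c !(innerDl, innerDr, innerNl, innerNr) !TtE.
  lra.
apply: (cvg_ge0 lim) => n.
have Fn : F (C z - T (y n) - lam n *: y n) (y n) := hy n.
have := sinv_mono Fn Fab; have := Tge0 (y n - p); rewrite (linearB T).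
have := mulr_ge0 (ltW (lam0 n)) (inner_ge0 (y n)).
have : lam n * [< b, y n >] <= lam n * (`|b| * M).
  by rewrite ler_pM2l// (le_trans (inner_le _ _))// ler_wpM2l.
rewrite /h /c !(innerDl, innerDr, innerNl, innerNr, innerZl, innerZr) !TtE.
rewrite !(innerC _ (y n)) !(innerC _ p) !(innerC _ b).
lra.
Qed.

End LureOperators.

(** * Resolvents of monotone operators and firm nonexpansiveness *)

Section Resolvents.
Context {R : realType} {H : hilbertType R}.
Implicit Types (A : H -> set H) (J : H -> H) (g : R).

Lemma resolvent_scaleP A g (z x : H) :
  resolvent (sscale g A) z x <-> exists u, A x u /\ x + g *: u = z.
Proof.
split=> [[_ -> [_ [u Au <-] <-]]|[u [Au <-]]]; first by exists u.
by exists x => //; exists (g *: u) => //; exists u.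
Qed.

Lemma is_resolventP A g J (z : H) : is_resolvent (sscale g A) J ->
  exists u, A (J z) u /\ J z + g *: u = z.
Proof. by move=> hJ; apply/resolvent_scaleP; rewrite hJ. Qed.

Lemma monotone_firm A g (x x' u u' : H) : monotone_op A -> 0 < g ->
  A x u -> A x' u' ->
  `|x - x'| ^+ 2 <= [< (x + g *: u) - (x' + g *: u'), x - x' >].
Proof.
move=> Amon g0 Au Au'; rewrite opprD addrACA -scalerBr innerDl innerZl.
by rewrite -inner_normE lerDl pmulr_rge0//; exact: Amon.
Qed.

(** Surjectivity gives a value at each point, and firmness makes it unique. *)
Lemma is_resolvent_exists A g : monotone_op A -> 0 < g ->
  (forall z, exists x u, A x u /\ x + g *: u = z) ->
  exists J, is_resolvent (sscale g A) J.
Proof.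
move=> Amon g0 surj; have [J hJ] := choice surj.
exists J => z; rewrite eqEsubset; split=> x.
  move=> /resolvent_scaleP[u [Au xu]]; have [u' [Au' Ju']] := hJ z.
  have := monotone_firm Amon g0 Au Au'; rewrite xu Ju' subrr inner0l.
  by rewrite inner_normE => /inner_le0_eq0/eqP; rewrite subr_eq0 => /eqP.
by move=> ->; apply/resolvent_scaleP; exact: hJ.
Qed.

Lemma resolvent_firm A g J (z z' : H) : monotone_op A -> 0 < g ->
  is_resolvent (sscale g A) J ->
  `|J z - J z'| ^+ 2 <= [< z - z', J z - J z' >].
Proof.
move=> Amon g0 hJ.
have [u [Au Ju]] := is_resolventP z hJ; have [u' [Au' Ju']] := is_resolventP z' hJ.
by have := monotone_firm Amon g0 Au Au'; rewrite Ju Ju'.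
Qed.

Lemma resolvent_nonexpansive A g J (z z' : H) : monotone_op A -> 0 < g ->
  is_resolvent (sscale g A) J -> `|J z - J z'| <= `|z - z'|.
Proof.
move=> Amon g0 hJ.
have [->|neq] := eqVneq (J z) (J z'); first by rewrite subrr normr0.
have n0 : 0 < `|J z - J z'| by rewrite normr_gt0 subr_eq0.
rewrite -(ler_pM2r n0) -expr2; apply: le_trans (inner_le _ _).
exact: resolvent_firm hJ.
Qed.

Lemma resolvent_fixed A g J p : monotone_op A -> 0 < g ->
  is_resolvent (sscale g A) J -> J p = p <-> A p 0.
Proof.
move=> Amon g0 hJ; split=> [Jp|A0].
  have [u [Au]] := is_resolventP p hJ; rewrite Jp => /eqP.
  rewrite -subr_eq0 addrC addKr scaler_eq0 gt_eqF//= => /eqP u0.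
  by rewrite -u0 -{1}Jp.
suff : resolvent (sscale g A) p p by rewrite hJ.
by apply/resolvent_scaleP; exists 0; rewrite scaler0 addr0.
Qed.

End Resolvents.

(** Were [B] missing from [F], the trace of [F] on its complement would be proper, and an
    ultrafilter above it would contain both sets. *)
Lemma ultra_subfilterP {T : Type} (F : set_system T) (B : set T) : Filter F ->
  (forall G, UltraFilter G -> F `<=` G -> G B) -> F B.
Proof.
move=> FF ultra; apply: contrapT => nFB.
have wP : ProperFilter (within (~` B) F).
  split; last exact: within_filter.
  move=> FB; apply: nFB.
  by apply: (@filterS _ F _ _ _ _ (FB : F [set t | ~ B t -> False])) => t /contrapT.
have [G [GU wG]] := ultraFilterLemma wP.
have GB : G B.
  by apply: ultra => // A FA; apply: wG; apply: filterS FA => t At _.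
have GnB : G (~` B) by apply: wG; exact: withinT.
apply: (@filter_not_empty _ G _); rewrite -(setICr B).
exact: (@filterI _ G _ _ _ GB GnB).
Qed.

(** * Weak convergence of the proximal point algorithm *)

Section ProximalPoint.
Context {R : realType} {H : hilbertType R}.
Variables (A : H -> set H) (g : R) (J : H -> H) (x : nat -> H).
Hypothesis Amon : monotone_op A.
Hypothesis g0 : 0 < g.
Hypothesis hJ : is_resolvent (sscale g A) J.
Hypothesis xS : forall n, x n.+1 = J (x n).

(** Firm nonexpansiveness against the fixed point [p]; the squared step is kept so that the steps
    can be shown to vanish. *)
Lemma prox_fejer p n : A p 0 ->
  `|x n.+1 - p| ^+ 2 + `|x n - x n.+1| ^+ 2 <= `|x n - p| ^+ 2.
Proof.
move=> /(resolvent_fixed p Amon g0 hJ) Jp.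
have := resolvent_firm (x n) p Amon g0 hJ; rewrite Jp -xS.
rewrite !innerE (innerC (x n.+1) (x n)) (innerC p (x n)) (innerC p (x n.+1)).
by lra.
Qed.

Lemma prox_dist_cvg p : A p 0 -> cvgn (fun n => `|x n - p| ^+ 2).
Proof.
move=> Ap; apply: nonincreasing_is_cvgn; last by exists 0 => _ [n _ <-].
apply/nonincreasing_seqP => n; have := prox_fejer n Ap.
by apply: le_trans; rewrite lerDl.
Qed.

Lemma prox_step_cvg0 p : A p 0 -> (fun n => `|x n - x n.+1|) @ \oo --> (0 : R).
Proof.
move=> Ap; pose d n := `|x n - p| ^+ 2.
have dl : d @ \oo --> limn d by exact: prox_dist_cvg.
have dl' : (fun n => d n.+1) @ \oo --> limn d by move: dl; rewrite -cvg_shiftS.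
have dd : (fun n => d n - d n.+1) @ \oo --> (0 : R).
  by rewrite -(subrr (limn d)); exact: cvgB.
apply/cvgrPdist_lt => e e0; have e2 : 0 < e ^+ 2 by rewrite exprn_gt0.
move/cvgrPdist_lt: dd => /(_ _ e2); apply: filterS => n.
rewrite !sub0r !normrN normr_id => dn.
rewrite -ltr_sqr ?nnegrE ?(ltW e0)//; apply: le_lt_trans dn.
apply: le_trans (ler_norm _); have := prox_fejer n Ap; rewrite /d.
by lra.
Qed.

Lemma prox_bounded p : A p 0 -> exists M, forall n, `|x n| <= M.
Proof.
move=> Ap; exists (`|x 0%N - p| + `|p|).
have dec n : `|x n - p| <= `|x 0%N - p|.
  elim: n => // n; apply: le_trans.
  rewrite -ler_sqr ?nnegrE//; have := prox_fejer n Ap.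
  by apply: le_trans; rewrite lerDl.
by move=> n; rewrite -{1}(subrK p (x n)) (le_trans (ler_normD _ _))// lerD2r.
Qed.

Lemma prox_demiclosed p (G : set_system nat) q : A p 0 ->
  UltraFilter G -> \oo `<=` G ->
  (forall h, [< x n, h >] @[n --> G] --> [< q, h >]) -> A q 0.
Proof.
move=> Ap GU Goo xq; apply/(resolvent_fixed q Amon g0 hJ).
have [M hM] := prox_bounded Ap; have M0 : 0 <= M := le_trans (normr_ge0 _) (hM 0%N).
(* Firmness between [x n] and [q] is affine in [x n] up to an error [K] times the step: [M + |J q|]
   bounds [x n.+1 - J q], and the last term pays for replacing [x n.+1] by [x n]. The limit says
   that minus the squared norm of [q - J q] is nonnegative. *)
pose K := M + `|J q| + `|q - J q|.
have lim : `|x n - x n.+1| * K - [< x n, q - J q >] + [< J q, q - J q >]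
    @[n --> G] --> 0 * K - [< q, q - J q >] + [< J q, q - J q >].
  apply: cvgD; last exact: cvg_cst.
  apply: cvgB (xq _); apply: cvgM; last exact: cvg_cst.
  by apply: cvg_trans (prox_step_cvg0 Ap); exact: cvg_app.
have step n : 0 <= `|x n - x n.+1| * K - [< x n, q - J q >] + [< J q, q - J q >].
  have := resolvent_firm (x n) q Amon g0 hJ; rewrite -xS.
  have b1 : [< x n - x n.+1, x n.+1 - J q >] <= `|x n - x n.+1| * (M + `|J q|).
    rewrite (le_trans (inner_le _ _))// ler_wpM2l// (le_trans (ler_normB _ _))//.
    by rewrite lerD2r.
  have b2 := inner_le (x n - x n.+1) (q - J q).
  move: b1 b2; rewrite /K !mulrDr; set e := `|x n - x n.+1|.
  move: (e * M) (e * `|J q|) (e * `|q - J q|) => a1 a2 a3.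
  rewrite !innerE (innerC q (x n.+1)) (innerC (J q) (x n.+1)) (innerC (J q) q).
  by lra.
have : 0 <= 0 * K - [< q, q - J q >] + [< J q, q - J q >].
  exact: cvg_ge0 lim step.
rewrite mul0r sub0r addrC -innerNl -innerDl.
rewrite -opprB innerNl oppr_ge0 => /inner_le0_eq0/eqP.
by rewrite subr_eq0 => /eqP.
Qed.

(* Opial: [|x n - p1|^2 - |x n - p2|^2] converges, hence so does
   [< x n, p1 - p2 >], and all weak cluster points coincide. *)
Lemma prox_weak_limit_unique p1 p2 (G1 G2 : set_system nat) :
  A p1 0 -> A p2 0 ->
  UltraFilter G1 -> UltraFilter G2 -> \oo `<=` G1 -> \oo `<=` G2 ->
  (forall h, [< x n, h >] @[n --> G1] --> [< p1, h >]) ->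
  (forall h, [< x n, h >] @[n --> G2] --> [< p2, h >]) -> p1 = p2.
Proof.
move=> A1 A2 GU1 GU2 sub1 sub2 x1 x2.
have c1 := prox_dist_cvg A1; have c2 := prox_dist_cvg A2.
pose u n := (`|x n - p2| ^+ 2 - `|x n - p1| ^+ 2 + `|p1| ^+ 2 - `|p2| ^+ 2) / 2.
have uE : (fun n => [< x n, p1 - p2 >]) = u.
  apply/funext => n; rewrite /u !innerE (innerC p1 (x n)) (innerC p2 (x n)).
  by lra.
have [L uL] : exists L : R, u @ \oo --> L.
  exists ((limn (fun n => `|x n - p2| ^+ 2) - limn (fun n => `|x n - p1| ^+ 2)
           + `|p1| ^+ 2 - `|p2| ^+ 2) / 2).
  apply: cvgM; last exact: cvg_cst.
  apply: cvgB; last exact: cvg_cst.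
  apply: cvgD; last exact: cvg_cst.
  by apply: cvgB; [exact: c2|exact: c1].
have e1 : [< p1, p1 - p2 >] = L.
  apply: (cvg_unique (@Rhausdorff R) (x1 (p1 - p2))); rewrite uE.
  by apply: cvg_trans uL; exact: cvg_app.
have e2 : [< p2, p1 - p2 >] = L.
  apply: (cvg_unique (@Rhausdorff R) (x2 (p1 - p2))); rewrite uE.
  by apply: cvg_trans uL; exact: cvg_app.
apply/eqP; rewrite -subr_eq0; apply/eqP/inner_le0_eq0.
by rewrite innerDl innerNl e1 e2 subrr.
Qed.

Lemma prox_weak_cvg : (exists p, A p 0) -> exists2 p, A p 0 & weak_cvg x p.
Proof.
move=> [p0 Ap0]; have [M hM] := prox_bounded Ap0.
have [G [GU Goo]] := @ultraFilterLemma nat \oo _.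
have [p hp] := weak_ultralimit GU hM.
have Ap := prox_demiclosed Ap0 GU Goo hp.
(* Convergence is tested along every ultrafilter above [\oo]; each has a weak limit, always equal to
   [p]. *)
exists p => // h; apply/cvgrPdist_lt => e e0; apply: ultra_subfilterP => G' GU' Goo'.
have [p' hp'] := weak_ultralimit GU' hM.
have Ap' := prox_demiclosed Ap0 GU' Goo' hp'.
rewrite (prox_weak_limit_unique Ap Ap' GU GU' Goo Goo' hp hp').
by have /cvgrPdist_lt := hp' h; exact.
Qed.

End ProximalPoint.

(** * Monotonicity and resolvent of the operator [lureH] *)

Section LureSystem.
Context {R : realType} {H1 H2 : hilbertType R}.
Variables (f : H1 -> H1) (Lf : R).
Variables (B : {linear H2 -> H1}) (C : {linear H1 -> H2}) (D : {linear H2 -> H2}).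
Variables (P : {linear H1 -> H1}) (F : H2 -> set H2).
Hypothesis f_lip : Lf.-lipschitz f.
Hypothesis Bb : bounded_op B.
Hypothesis Cb : bounded_op C.
Hypothesis Db : bounded_op D.
Hypothesis Pb : bounded_op P.
Hypothesis Dsc : semi_coercive D.
Hypothesis Ppd : positive_definite P.
Hypothesis pass : passive P f B C D.
Hypothesis Fmm : maximal_monotone F.

Let Fmon : monotone_op F := Fmm.1.

Lemma passive_ge0 y : 0 <= [< D y, y >].
Proof.
by have := pass 0 0 y 0; rewrite !subrr !inner0r !add0r subr0.
Qed.

Lemma lureB_monotone : monotone_op (lureB F D).
Proof.
move=> u1 u2 y1 y2 F1 F2; rewrite innerC.
exact: le_trans (passive_ge0 _) (lureB_mono Fmon F1 F2).
Qed.

Lemma lureG_monotone : monotone_op (lureG C F D).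
Proof.
move=> x1 x2 _ _ [y1 F1 <-] [y2 F2 <-].
rewrite -(adjointB Cb) innerC -adjointP// (linearB C) innerC; exact: lureB_monotone.
Qed.

Lemma lureHE x w :
  lureH P f B C D F x w <-> exists2 y, lureB F D (C x) y & P (f x) + P (B y) = w.
Proof.
split=> [[_ -> [_ [y Fy <-] <-]]|[y Fy <-]]; first by exists y.
by exists (P (f x)) => //; exists (P (B y)) => //; exists y.
Qed.

(** Besides the pairing for [lureH], passivity contains [D] paired on [y1 - y2] minus
    [C^T (y1 - y2)] paired with [x1 - x2], a difference that is nonpositive by [lureB_mono]. *)
Lemma lureH_monotone : monotone_op (lureH P f B C D F).
Proof.
move=> x1 x2 w1 w2 /lureHE[y1 F1 <-] /lureHE[y2 F2 <-].
have := pass x1 x2 y1 y2; have := lureB_mono Fmon F1 F2.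
rewrite -(linearB C) (adjointP Cb) (linearB B) !(linearB P).
rewrite opprD addrACA !(innerDl, innerNl) (innerC (adjoint C _) (x1 - x2)).
by rewrite innerDl innerNl; lra.
Qed.

(** Positive definiteness makes [P] injective, so multiplying by it creates no new zeros. *)
Lemma equilibriumE x : equilibrium f B C D F x <-> lureH P f B C D F x 0.
Proof.
split=> [[_ -> [_ [y Fy <-] e]]|/lureHE[y Fy]].
  by apply/lureHE; exists y => //; rewrite -linearD e linear0.
rewrite -linearD => e; have [c c0 hc] := Ppd.
have := hc (f x + B y); rewrite e inner0l pmulr_rle0// inner_normE.
move=> /inner_le0_eq0 z; exists (f x) => //; exists (B y) => //; by exists y.
Qed.

(* On the fibres of [lureB F D] the form [D] degenerates, and passivity with
   arbitrarily large multiples of [y1 - y2] forces [P B = C^T] there. *)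
Lemma lureB_fibre x y1 y2 : lureB F D (C x) y1 -> lureB F D (C x) y2 ->
  P (B y1) - adjoint C y1 = P (B y2) - adjoint C y2.
Proof.
move=> F1 F2; have Dle0 := lureB_mono Fmon F1 F2.
rewrite subrr inner0l in Dle0.
pose d := y1 - y2; suff : P (B d) - adjoint C d = 0.
  rewrite /d (linearB B) (linearB P) (adjointB Cb) => e.
  apply/eqP; rewrite -subr_eq0; apply/eqP; rewrite -[RHS]e !opprB.
  by rewrite addrACA [RHS]addrACA (addrC (- adjoint C y1)).
apply: inner_inj => w; rewrite inner0r innerC.
set a := inner _ _; pose a0 := [< P (f w - f 0), w >].
have lin t : 0 <= a0 + t * a.
  have := pass w 0 (t *: d) 0; rewrite !subr0.
  have -> : P (B (t *: d)) = t *: P (B d) by rewrite !linearZ.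
  have -> : D (t *: d) = t *: D d by rewrite linearZ.
  rewrite (adjointZ t Cb) -scalerBr !innerZl innerZr.
  rewrite -/a0 -/a => /le_trans; apply.
  by rewrite gerDl mulrA -expr2 mulr_ge0_le0 ?sqr_ge0.
have [//|an0] := eqVneq a 0.
(* This [t] gives the affine function the value -1. *)
have := lin (- (a0 + 1) / a); rewrite divfK//.
by lra.
Qed.

(** Two points selected in [y0 + rge (D + D^T)] differ by an element of that range, where
    semi-coercivity and [lureB_mono] make the selection [Y] Lipschitz with constant [kc / c]. By
    [lureB_fibre] the correction [P B - C^T] takes the same value at [Y x] as at any other [y]. *)
Lemma lureH_splitting y0 :
  (forall x : H1, srge (finvD F D) (C x) ->
     [set y0 + z | z in rge_sym D] `&` lureB F D (C x) !=set0) ->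
  exists (h : H1 -> H1) (L : R), [/\ 0 < L,
    forall x1 x2, srge (finvD F D) (C x1) -> srge (finvD F D) (C x2) ->
      `|h x1 - h x2| <= L * `|x1 - x2| &
    forall x y, lureB F D (C x) y -> P (f x) + P (B y) = h x + adjoint C y].
Proof.
move=> sel.
have ex x : exists y, srge (finvD F D) (C x) ->
    [set y0 + z | z in rge_sym D] y /\ lureB F D (C x) y.
  have [/sel[y [y0y Fy]]|ndom] := pselect (srge (finvD F D) (C x)).
    by exists y.
  (* Off the domain the selection is arbitrary; the Lipschitz bound is claimed on the domain
     only. *)
  by exists 0 => /ndom.
have [Y hY] := choice ex.
have [c c0 hc] := Dsc.
have [kb kb0 hb] := bounded_op_gt0 Bb.
have [kc kc0 hkc] := bounded_op_gt0 Cb.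
have [kt kt0 ht] := bounded_op_gt0 (bounded_adjoint Cb).
have [kp kp0 hp] := bounded_op_gt0 Pb.
exists (fun x => P (f x) + (P (B (Y x)) - adjoint C (Y x))).
exists (kp * (`|Lf| + 1) + (kp * kb + kt) * (kc / c)); split.
- apply: addr_gt0; apply: mulr_gt0 => //; last exact: divr_gt0.
  by rewrite addr_gt0// mulr_gt0.
- move=> x1 x2 /hY[[_ [z1 _ <-] Y1] F1] /hY[[_ [z2 _ <-] Y2] F2].
  have Ylip : `|Y x1 - Y x2| <= kc / c * `|x1 - x2|.
    have rge : rge_sym D (Y x1 - Y x2).
      exists (z1 - z2) => //; rewrite (linearB D) (adjointB Db) addrACA -opprD.
      by rewrite -Y1 -Y2 (opprD y0) [RHS]addrACA subrr add0r.
    have := hc _ rge; have := lureB_mono Fmon F1 F2.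
    rewrite -(linearB C) => h1 h2; have {}h1 := le_trans h2 h1.
    have [->|n0] := eqVneq (Y x1) (Y x2).
      by rewrite subrr normr0 !mulr_ge0 ?invr_ge0// ltW.
    have {}n0 : 0 < `|Y x1 - Y x2| by rewrite normr_gt0 subr_eq0.
    rewrite mulrAC ler_pdivlMr// mulrC -(ler_pM2r n0) -mulrA -expr2.
    apply: le_trans h1 _; apply: le_trans (inner_le _ _) _.
    by rewrite ler_pM2r// hkc.
  rewrite opprD addrACA mulrDl (le_trans (ler_normD _ _))// lerD//.
    rewrite -(linearB P) (le_trans (hp _))// -mulrA ler_pM2l//.
    have /= := @f_lip (x1, x2) (conj Logic.I Logic.I); move=> /le_trans; apply.
    by rewrite ler_wpM2r// (le_trans (ler_norm _))// lerDl.
  rewrite (opprD (P (B (Y x2)))) addrACA -opprD -(linearB P).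
  rewrite -(linearB B) -(adjointB Cb) (le_trans (ler_normB _ _))//.
  rewrite -mulrA; apply: (@le_trans _ _ ((kp * kb + kt) * `|Y x1 - Y x2|)).
    by rewrite mulrDl lerD// (le_trans (hp _))// -mulrA ler_pM2l.
  by rewrite ler_pM2l// addr_gt0// mulr_gt0.
- move=> x y Fy; have [_ FY] := hY x (ex_intro _ y Fy).
  by rewrite -(lureB_fibre Fy FY) -addrA subrK.
Qed.

(* With [h] Lipschitz on the domain of [G] and [lureH = h + G], the equation
   [x + g (h x + C^T y) = z] reads [w = h (JG (z - g w))] with [w = h x], a
   fixed point problem on the whole space for a contraction. *)
Lemma lureH_resolvent_surj y0 :
  (forall x : H1, srge (finvD F D) (C x) ->
     [set y0 + z | z in rge_sym D] `&` lureB F D (C x) !=set0) ->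
  exists2 g0 : R, 0 < g0 & forall (g : R) JG, 0 < g < g0 ->
    is_resolvent (sscale g (lureG C F D)) JG ->
    forall z, exists x w, lureH P f B C D F x w /\ x + g *: w = z.
Proof.
move=> /lureH_splitting[h [L [L0 hL hE]]]; exists L^-1; first by rewrite invr_gt0.
move=> g JG /andP[g0 gL] hJG z.
have JGP w : exists2 y, lureB F D (C (JG w)) y & JG w + g *: adjoint C y = w.
  by have [_ [[y Fy <-] e]] := is_resolventP w hJG; exists y.
have gL1 : g * L < 1 by rewrite -ltr_pdivlMr// div1r.
have gL0 : 0 <= g * L by rewrite mulr_ge0// ltW.
have [|w hw] := contraction_fixpoint (phi := fun w => h (JG (z - g *: w))) gL0 gL1.
  move=> w w'; have [y Fy _] := JGP (z - g *: w).
  have [y' Fy' _] := JGP (z - g *: w').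
  apply: le_trans (hL _ _ (ex_intro _ y Fy) (ex_intro _ y' Fy')) _.
  rewrite (mulrC g) -mulrA ler_pM2l//.
  apply: le_trans (resolvent_nonexpansive _ _ lureG_monotone g0 hJG) _.
  by rewrite opprD addrACA subrr add0r -opprD normrN -scalerBr normrZ gtr0_norm.
have [y Fy e] := JGP (z - g *: w).
exists (JG (z - g *: w)), (h (JG (z - g *: w)) + adjoint C y); split.
  by apply/lureHE; exists y => //; exact: hE.
by rewrite hw scalerDr addrCA e addrC subrK.
Qed.

End LureSystem.

(** * Existence of the three resolvents and weak convergence to an equilibrium *)

Theorem theorem9 (R : realType) (H1 H2 : hilbertType R)
    (f : H1 -> H1) (Lf : R)
    (B : {linear H2 -> H1}) (C : {linear H1 -> H2}) (D : {linear H2 -> H2})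
    (P : {linear H1 -> H1}) (F : H2 -> set H2) :
  Lf.-lipschitz f ->
  bounded_op B -> bounded_op C -> bounded_op D -> bounded_op P ->
  semi_coercive D ->
  symmetric_op P -> positive_definite P ->
  passive P f B C D ->
  maximal_monotone F ->
  relint [set u - v | u in range C & v in srge (finvD F D)] 0 ->
  (exists y0 : H2, forall x : H1, srge (finvD F D) (C x) ->
     [set y0 + z | z in rge_sym D] `&` lureB F D (C x) !=set0) ->
  exists2 g0 : R, 0 < g0 & forall g : R, 0 < g < g0 ->
    exists (JB : H2 -> H2) (JG JH : H1 -> H1),
      [/\ is_resolvent (sscale g (lureB F D)) JB,
          is_resolvent (sscale g (lureG C F D)) JG,
          is_resolvent (sscale g (lureH P f B C D F)) JH &
          (* without an equilibrium no sequence can converge to one *)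
          equilibrium f B C D F !=set0 ->
          forall x : nat -> H1, (forall n, x n.+1 = JH (x n)) ->
            exists2 xstar : H1, equilibrium f B C D F xstar & weak_cvg x xstar].
Proof.
move=> f_lip Bb Cb Db Pb Dsc _ Ppd pass Fmm ri [y0 sel].
have Fmon := Fmm.1; have Fmax := maximal_monotone_related Fmm.
have Dge0 := passive_ge0 pass.
have Gmon := lureG_monotone Cb pass Fmm.
have Hmon := lureH_monotone Cb pass Fmm.
have [g0 g0_gt0 surjH] :=
  lureH_resolvent_surj f_lip Bb Cb Db Pb Dsc pass Fmm sel.
(* The threshold comes from [lureH] alone; the other two resolvents exist for every positive
   step. *)
exists g0 => // g gg0; have /andP[g_gt0 _] := gg0.
have [JB hJB] := is_resolvent_exists (lureB_monotone pass Fmm) g_gt0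
  (fun z => lureB_resolvent_surj Db Dge0 Fmon Fmax z g_gt0).
have [|JG hJG] := is_resolvent_exists Gmon g_gt0.
  move=> z; have [x [y [Fy e]]] :=
    lureG_resolvent_surj Cb Db Dge0 Fmon Fmax z ri g_gt0.
  by exists x, (adjoint C y); split=> //; exists y.
have [JH hJH] := is_resolvent_exists Hmon g_gt0 (surjH g JG gg0 hJG).
exists JB, JG, JH; split=> // -[xeq /(equilibriumE f B C D F Ppd) Heq] x xS.
have [p Hp xp] := prox_weak_cvg Hmon g_gt0 hJH xS (ex_intro _ xeq Heq).
by exists p => //; exact/(equilibriumE f B C D F Ppd).
Qed.
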